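(* Let $A$ be a symmetric $n\times n$ integer matrix all of whose diagonal entries are even. Then there exist an integer matrix $P$ with $\det(P)=\pm 1$ and non-negative integers $p,r,s,t,m$ such that $P^TAP \pmod{4}$ equals the block diagonal matrix $$N(r,s,t,p,m)=\mathrm{diag}\Big(r\begin{pmatrix}2&1\\1&2\end{pmatrix},\ s\begin{pmatrix}0&1\\1&0\end{pmatrix},\ t\begin{pmatrix}0&2\\2&0\end{pmatrix},\ p\,(2),\ m\,(0)\Big).$$
   Context: For a matrix $M$, ''$M \pmod 4$'' denotes the matrix of entrywise reductions modulo $4$ (entries in $\{0,1,2,3\}$). The notation $\mathrm{diag}(m_1A_1,\dots,m_kA_k)$ denotes the block diagonal matrix whose diagonal blocks are $m_1$ copies of $A_1$, then $m_2$ copies of $A_2$, ..., then $m_k$ copies of $A_k$. Such a matrix $N(r,s,t,p,m)$ is called a normal form of $A$. *)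

(* Defs.v *)
From mathcomp Require Import all_boot all_order all_algebra.

Set Implicit Arguments.
Unset Strict Implicit.
Unset Printing Implicit Defensive.

Import GRing.Theory.
Local Open Scope ring_scope.

Definition mod4_mx (m n : nat) (M : 'M[int]_(m, n)) : 'M[int]_(m, n) :=
  map_mx (fun x : int => (x %% 4)%Z) M.

Definition copies_dim (k d : nat) : nat := (\sum_(i < k) d)%N.

Definition copies (k d : nat) (B : 'M[int]_d) : 'M[int]_(copies_dim k d) :=
  \mxdiag_(i < k) B.

Definition diag2 (d1 d2 : nat) (B1 : 'M[int]_d1) (B2 : 'M[int]_d2) :
    'M[int]_(d1 + d2) :=
  block_mx B1 0 0 B2.

(* The matrix (a b; b a). *)
Definition sym2 (a b : int) : 'M[int]_2 :=
  \matrix_(i < 2, j < 2) (if i == j then a else b).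

Definition normal_form_dim (r s t p m : nat) : nat :=
  (copies_dim r 2 + (copies_dim s 2 + (copies_dim t 2 +
     (copies_dim p 1 + copies_dim m 1))))%N.

Definition normal_form (r s t p m : nat) :
    'M[int]_(normal_form_dim r s t p m) :=
  diag2 (copies r (sym2 2 1))
    (diag2 (copies s (sym2 0 1))
      (diag2 (copies t (sym2 0 2))
        (diag2 (copies p (2%:M : 'M[int]_1))
               (copies m (0%:M : 'M[int]_1))))).

(* Main.v *)
Require Import Defs.
From mathcomp Require Import all_boot all_order all_algebra all_fingroup.
From mathcomp Require Import zify ring.

(** Induction on the size, splitting off one orthogonal block at a time.  If
    some entry is odd, it lies off the diagonal, and the 2x2 block it spans has
    even diagonal, hence determinant -1 modulo 4: it is invertible modulo 4, so
    it splits off, and a change of basis turns it into (2 1; 1 2) or (0 1; 1 0).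
    If all entries are even, a diagonal entry 2 modulo 4 divides its row modulo
    4 and splits off; if the diagonal vanishes modulo 4, an off-diagonal entry 2
    gives a block (0 2; 2 0) that splits off for the same reason; otherwise the
    matrix is 0 modulo 4.  The blocks are then sorted by permuting them. *)

Set Implicit Arguments.
Unset Strict Implicit.
Unset Printing Implicit Defensive.

Import GRing.Theory.
Local Open Scope ring_scope.

(** * Congruence modulo 4 and integral change of basis *)

Definition eqmx4 m n (M N : 'M[int]_(m, n)) := exists K, M = N + 4 *: K.

(* A and B may have different (only provably equal) sizes, which avoids casts
   when blocks are reassociated. *)
Definition congr4 n k (A : 'M[int]_n) (B : 'M[int]_k) :=
  exists (Q : 'M[int]_(n, k)) (Q' : 'M[int]_(k, n)),
    [/\ Q *m Q' = 1%:M, Q' *m Q = 1%:M & eqmx4 (Q^T *m A *m Q) B].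

(* Being of the form U + U^T is symmetry with even diagonal (see [even_symP]);
   in this form it is visibly preserved by congruences. *)
Definition even_sym n (A : 'M[int]_n) := exists U, A = U + U^T.

Lemma eqmx4P m n (M N : 'M[int]_(m, n)) :
  (forall i j, (4 %| M i j - N i j)%Z) -> eqmx4 M N.
Proof.
move=> dMN; exists (\matrix_(i, j) ((M i j - N i j) %/ 4)%Z).
by apply/matrixP=> i j; rewrite !mxE mulrC divzK // subrKC.
Qed.

Lemma eqmx4_mod4 m n (M N : 'M[int]_(m, n)) :
  eqmx4 M N -> mod4_mx M = mod4_mx N.
Proof.
by case=> K ->; apply/matrixP=> i j; rewrite !mxE addrC mulrC modzMDl.
Qed.

Lemma congr4_trans n k l (A : 'M[int]_n) (B : 'M[int]_k) (C : 'M[int]_l) :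
  congr4 A B -> congr4 B C -> congr4 A C.
Proof.
move=> [Q [Q' [QQ' Q'Q [K QE]]]] [R [R' [RR' R'R [L RE]]]].
exists (Q *m R), (R' *m Q'); split.
- by rewrite mulmxA -(mulmxA Q) RR' mulmx1.
- by rewrite mulmxA -(mulmxA R') Q'Q mulmx1.
exists (L + R^T *m K *m R).
rewrite trmx_mul -!mulmxA (mulmxA A) (mulmxA Q^T) (mulmxA Q^T) QE.
rewrite mulmxDl mulmxDr mulmxA RE -scalemxAl -scalemxAr scalerDr addrA.
by rewrite mulmxA.
Qed.

Lemma eqmx4_congr4 n (A B : 'M[int]_n) : eqmx4 A B -> congr4 A B.
Proof.
by move=> AB; exists 1%:M, 1%:M; split; rewrite ?trmx1 ?mul1mx ?mulmx1.
Qed.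

Lemma congr4_refl n (A : 'M[int]_n) : congr4 A A.
Proof. by apply: eqmx4_congr4; exists 0; rewrite scaler0 addr0. Qed.

Lemma congr4_cast n k (e : n = k) (A : 'M[int]_n) : congr4 A (castmx (e, e) A).
Proof. by case: k / e; rewrite castmx_id; exact: congr4_refl. Qed.

Lemma congr4_castl n k (e : n = k) (A : 'M[int]_n) : congr4 (castmx (e, e) A) A.
Proof. by case: k / e; rewrite castmx_id; exact: congr4_refl. Qed.

(** * Rearranging block diagonal sums *)

Lemma congr4_diag2 n k l m (A : 'M[int]_n) (B : 'M[int]_k)
    (C : 'M[int]_l) (D : 'M[int]_m) :
  congr4 A B -> congr4 C D -> congr4 (diag2 A C) (diag2 B D).
Proof.
move=> [Q [Q' [QQ' Q'Q [K QE]]]] [R [R' [RR' R'R [L RE]]]].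
exists (block_mx Q 0 0 R), (block_mx Q' 0 0 R'); split.
- by rewrite mulmx_block !(mulmx0, mul0mx, addr0, add0r) QQ' RR' -scalar_mx_block.
- by rewrite mulmx_block !(mulmx0, mul0mx, addr0, add0r) Q'Q R'R -scalar_mx_block.
exists (block_mx K 0 0 L).
rewrite /diag2 tr_block_mx !trmx0 !mulmx_block !(mulmx0, mul0mx, addr0, add0r).
by rewrite QE RE scale_block_mx add_block_mx !scaler0 !addr0.
Qed.

Lemma congr4_diag2C n k (A : 'M[int]_n) (B : 'M[int]_k) :
  congr4 (diag2 A B) (diag2 B A).
Proof.
exists (block_mx 0 1%:M 1%:M 0), (block_mx 0 1%:M 1%:M 0); split.
- by rewrite mulmx_block !(mulmx0, mul0mx, addr0, add0r) !mulmx1 -scalar_mx_block.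
- by rewrite mulmx_block !(mulmx0, mul0mx, addr0, add0r) !mulmx1 -scalar_mx_block.
exists 0; rewrite scaler0 addr0 /diag2 tr_block_mx !trmx0 !trmx1 !mulmx_block.
by rewrite !(mulmx0, mul0mx, addr0, add0r, mulmx1, mul1mx).
Qed.

Lemma congr4_diag2A n k l (A : 'M[int]_n) (B : 'M[int]_k) (C : 'M[int]_l) :
  congr4 (diag2 A (diag2 B C)) (diag2 (diag2 A B) C).
Proof.
have := @block_mxA _ _ _ _ _ _ _ A 0 0 0 B 0 0 0 C; rewrite /diag2 /= !row_mx0 !col_mx0.
by move=> ->; exact: congr4_castl.
Qed.

Lemma congr4_diag2Ar n k l (A : 'M[int]_n) (B : 'M[int]_k) (C : 'M[int]_l) :
  congr4 (diag2 (diag2 A B) C) (diag2 A (diag2 B C)).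
Proof.
have := @block_mxA _ _ _ _ _ _ _ A 0 0 0 B 0 0 0 C; rewrite /diag2 /= !row_mx0 !col_mx0.
by move=> ->; exact: congr4_cast.
Qed.

(** A block just split off arrives in front; this absorbs it into the run of its equals once that
    run comes next. *)
Lemma congr4_copies k d l (B : 'M[int]_d) (N : 'M[int]_l) :
  congr4 (diag2 B (diag2 (copies k B) N)) (diag2 (copies k.+1 B) N).
Proof.
apply: congr4_trans (congr4_diag2A _ _ _) _.
apply: congr4_diag2; last exact: congr4_refl.
by rewrite {2}/copies mxdiag_recl; exact: congr4_cast.
Qed.

(** Carries a new block past a run [M] of other blocks; iterated, it reaches the run where the block
    belongs. *)
Lemma congr4_skip d k l l' (B : 'M[int]_d) (M : 'M[int]_k)
    (N : 'M[int]_l) (N' : 'M[int]_l') :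
  congr4 (diag2 B N) N' -> congr4 (diag2 B (diag2 M N)) (diag2 M N').
Proof.
move=> BN; apply: congr4_trans (congr4_diag2A _ _ _) _.
have swap := congr4_diag2 (congr4_diag2C B M) (congr4_refl N).
apply: congr4_trans swap _; apply: congr4_trans (congr4_diag2Ar _ _ _) _.
exact: congr4_diag2 (congr4_refl _) BN.
Qed.

Lemma congr4_perm n (s : 'S_n) (A : 'M[int]_n) :
  congr4 A (\matrix_(i, j) A (s i) (s j)).
Proof.
exists (perm_mx s)^T, (perm_mx s); split.
- by rewrite tr_perm_mx -perm_mxM mulVg perm_mx1.
- by rewrite tr_perm_mx -perm_mxM mulgV perm_mx1.
exists 0; rewrite scaler0 addr0 trmxK tr_perm_mx -row_permE -col_permE.
by apply/matrixP=> i j; rewrite !mxE.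
Qed.

(** * Symmetric matrices with even diagonal *)

Lemma even_sym_tr n (A : 'M[int]_n) : even_sym A -> A^T = A.
Proof. by case=> U ->; rewrite linearD /= trmxK addrC. Qed.

Lemma even_sym_diag n (A : 'M[int]_n) i : even_sym A -> (2 %| A i i)%Z.
Proof. by case=> U ->; rewrite !mxE; apply/dvdzP; exists (U i i); ring. Qed.

Lemma even_symP n (A : 'M[int]_n) :
  A^T = A -> (forall i, (2 %| A i i)%Z) -> even_sym A.
Proof.
move=> A_sym A_even.
exists (\matrix_(i, j) if i == j then (A i i %/ 2)%Z
                       else if (i < j)%N then A i j else 0).
apply/matrixP=> i j; rewrite !mxE (eq_sym j i).
have AC : A j i = A i j by rewrite -{1}A_sym mxE.
case: eqVneq => [<-|ij]; first by have /divzK {1}<- := A_even i; ring.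
have : (i < j)%N \/ (j < i)%N by apply/orP; rewrite -neq_ltn.
by case=> h; rewrite h ltnNge ltnW //= ?addr0 ?add0r.
Qed.

Lemma even_sym_perm n (s : 'S_n) (A : 'M[int]_n) :
  even_sym A -> even_sym (\matrix_(i, j) A (s i) (s j)).
Proof.
case=> U ->; exists (\matrix_(i, j) U (s i) (s j)).
by apply/matrixP=> i j; rewrite !mxE.
Qed.

(** * Splitting off a block *)

(* Schur complement: the change of basis is [[1, -X], [0, 1]]. *)
Lemma congr4_split k n (A : 'M[int]_(k + n)) (X : 'M[int]_(k, n)) :
  even_sym A -> eqmx4 (ursubmx A) (ulsubmx A *m X) ->
  exists2 D : 'M[int]_n, even_sym D & congr4 A (diag2 (ulsubmx A) D).
Proof.
move=> eA [K CE]; have A_sym := even_sym_tr eA.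
set B := ulsubmx A in CE *; set D := drsubmx A.
have BT : B^T = B by rewrite trmx_ulsub A_sym.
have CT : dlsubmx A = (ursubmx A)^T by rewrite trmx_ursub A_sym.
(* The Schur complement, written without an inverse of [B], which may be singular modulo 4. If [A]
   is U + U^T and V is the corner of U, then [B] is V + V^T, so X^T B X also has the form W +
   W^T. *)
exists (D - X^T *m B *m X).
  case: eA => U AE; exists (drsubmx U - X^T *m ulsubmx U *m X).
  rewrite /D /B AE -{1 2 3 4}(submxK U) tr_block_mx add_block_mx.
  rewrite block_mxKul block_mxKdr linearB /= !trmx_mul trmxK.
  by rewrite mulmxDr mulmxDl !mulmxA !opprD addrACA.
exists (block_mx 1%:M (- X) 0 1%:M), (block_mx 1%:M X 0 1%:M); split.
- rewrite mulmx_block !(mulmx0, mul0mx, addr0, add0r, mulmx1, mul1mx).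
  by rewrite subrr -scalar_mx_block.
- rewrite mulmx_block !(mulmx0, mul0mx, addr0, add0r, mulmx1, mul1mx).
  by rewrite addNr -scalar_mx_block.
(* The terms in [B] cancel off the diagonal and leave 4K and 4K^T; the lower corner keeps the cross
   terms of 4K with X. *)
exists (block_mx 0 K K^T (- (X^T *m K) - K^T *m X)).
have CTE : dlsubmx A = X^T *m B + 4 *: K^T.
  by rewrite CT CE linearD linearZ /= trmx_mul BT.
have NXT : (- X)^T = - X^T by rewrite linearN.
rewrite -{1}(submxK A) CTE CE -/B -/D tr_block_mx !trmx1 trmx0 !mulmx_block.
rewrite !(mulmx0, mul0mx, addr0, add0r, mulmx1, mul1mx).
rewrite /diag2 scale_block_mx add_block_mx NXT.
rewrite !(mulmxDr, mulmxDl, mulNmx, mulmxN, scaler0, addr0, add0r, mulmxA).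
rewrite -scalemxAl -scalemxAr scalerDr !scalerN.
congr block_mx; first exact: addKr; first exact: addKr.
by rewrite addKr addrC (addrC _ D) !addrA.
Qed.

(** * Arithmetic of 2x2 blocks modulo 4 *)

(** The odd classes modulo 4 are represented by signs, which are units of the integers and so can be
    determinants of base changes. *)
Lemma mod4_odd (b : int) : ~~ (2 %| b)%Z ->
  exists2 e : int, e * e = 1 & (4 %| b - e)%Z.
Proof.
move=> b_odd; have [b1|b3] : (4 %| b - 1)%Z \/ (4 %| b + 1)%Z by lia.
  by exists 1.
by exists (- 1); rewrite // opprK.
Qed.

Lemma mod4_even (b : int) : (2 %| b)%Z -> (4 %| b)%Z \/ (4 %| b - 2)%Z.
Proof. lia. Qed.

Lemma ord2P (P : 'I_2 -> Prop) : P 0 -> P 1 -> forall i, P i.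
Proof.
by move=> P0 P1 [[|[|//]] i2]; [move: P0 | move: P1]; congr P; exact: val_inj.
Qed.

Definition mx2 (a b c d : int) : 'M[int]_2 :=
  \matrix_(i, j) if i == 0 then if j == 0 then a else b
                 else if j == 0 then c else d.

Lemma mx2E (B : 'M[int]_2) : B = mx2 (B 0 0) (B 0 1) (B 1 0) (B 1 1).
Proof. by apply/matrixP; do 2!apply: ord2P; rewrite mxE. Qed.

Lemma mul_mx2 a b c d a' b' c' d' :
  mx2 a b c d *m mx2 a' b' c' d' =
  mx2 (a * a' + b * c') (a * b' + b * d') (c * a' + d * c') (c * b' + d * d').
Proof.
by apply/matrixP; do 2!apply: ord2P; rewrite !mxE !big_ord_recl big_ord0 !mxE addr0.
Qed.

Lemma tr_mx2 a b c d : (mx2 a b c d)^T = mx2 a c b d.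
Proof. by apply/matrixP; do 2!apply: ord2P; rewrite !mxE. Qed.

Lemma mx2_1 : mx2 1 0 0 1 = 1%:M.
Proof. by apply/matrixP; do 2!apply: ord2P; rewrite !mxE. Qed.

Lemma sym2E a b : sym2 a b = mx2 a b b a.
Proof. by apply/matrixP; do 2!apply: ord2P; rewrite !mxE. Qed.

Lemma eqmx4_mx2 a b c d a' b' c' d' :
  (4 %| a - a')%Z -> (4 %| b - b')%Z -> (4 %| c - c')%Z -> (4 %| d - d')%Z ->
  eqmx4 (mx2 a b c d) (mx2 a' b' c' d').
Proof. by move=> *; apply: eqmx4P; do 2!apply: ord2P; rewrite !mxE. Qed.

(* The block has determinant -1 modulo 4, so minus its adjugate inverts it. *)
Lemma odd_block_inv (B : 'M[int]_2) :
  even_sym B -> ~~ (2 %| B 0%R 1%R)%Z -> exists Y, eqmx4 (B *m Y) 1%:M.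
Proof.
move=> eB; have := even_sym_diag 0 eB; have := even_sym_diag 1 eB.
have : B 1 0 = B 0 1 by rewrite -{1}(even_sym_tr eB) mxE.
rewrite (mx2E B); move: (B 0 0) (B 0 1) (B 1 0) (B 1 1) => a b c d.
rewrite !mxE /= => -> /dvdzP[d' ->] /dvdzP[a' ->] b_odd.
exists (mx2 (- (d' * 2)) b b (- (a' * 2))).
(* The square of b is 1 modulo 4, and the product of the two even diagonal entries is 0 modulo 4. *)
have [e e2 /dvdzP[k /eqP]] := mod4_odd b_odd; rewrite subr_eq => /eqP->.
rewrite mul_mx2 -mx2_1; apply: eqmx4_mx2; nia.
Qed.

(** Since e inverts the determinant, e times the adjugate is an exact integral inverse. *)
Lemma congr4_mx2 B a b c d a' b' c' d' e :
  e * (a * d - b * c) = 1 ->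
  eqmx4 (mx2 a c b d *m B *m mx2 a b c d) (mx2 a' b' c' d') ->
  congr4 B (mx2 a' b' c' d').
Proof.
move=> de BE; exists (mx2 a b c d), (mx2 (e * d) (- (e * b)) (- (e * c)) (e * a)).
rewrite tr_mx2; split=> //; rewrite mul_mx2 -mx2_1; congr mx2; rewrite -?de; ring.
Qed.

Lemma odd_block_congr4 (B : 'M[int]_2) : even_sym B -> ~~ (2 %| B 0%R 1%R)%Z ->
  congr4 B (sym2 2 1) \/ congr4 B (sym2 0 1).
Proof.
move=> eB; have := even_sym_diag 0 eB; have := even_sym_diag 1 eB.
have : B 1 0 = B 0 1 by rewrite -{1}(even_sym_tr eB) mxE.
rewrite (mx2E B); move: (B 0 0) (B 0 1) (B 1 0) (B 1 1) => a b c d.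
rewrite !mxE /= !sym2E => -> /mod4_even d4 /mod4_even a4 /mod4_odd[e e2 be].
(* Scaling the second basis vector by e makes the off-diagonal entry 1. If just one diagonal entry
   is 2, replacing its vector by a difference of the two vectors changes it to 2 - 2 = 0. Only the
   diagonal (2, 2) leads to (2 1; 1 2). *)
case: a4 d4 => [a0|a2] [d0|d2]; [right|right|right|left].
- apply: (@congr4_mx2 _ 1 0 0 e _ _ _ _ e); first lia.
  by rewrite !mul_mx2; apply: eqmx4_mx2; nia.
- apply: (@congr4_mx2 _ 1 (- 1) 0 e _ _ _ _ e); first lia.
  by rewrite !mul_mx2; apply: eqmx4_mx2; nia.
- apply: (@congr4_mx2 _ 1 0 (- e) e _ _ _ _ e); first lia.
  by rewrite !mul_mx2; apply: eqmx4_mx2; nia.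
- apply: (@congr4_mx2 _ 1 0 0 e _ _ _ _ e); first lia.
  by rewrite !mul_mx2; apply: eqmx4_mx2; nia.
Qed.

(** * Splitting off each type of block *)

(** Replacing the corner by a congruent [B] changes its product with [X] only by a multiple of 4, so
    solvability may be tested on [B]. *)
Lemma congr4_split_eqmx4 k n (A : 'M[int]_(k + n)) (B : 'M[int]_k)
    (X : 'M[int]_(k, n)) :
  even_sym A -> eqmx4 (ulsubmx A) B -> ursubmx A = B *m X ->
  exists2 D : 'M[int]_n, even_sym D & congr4 A (diag2 B D).
Proof.
move=> eA AB CE; case: (AB) => K BE.
have [|D eD AD] := @congr4_split _ _ A X eA.
  by exists (- (K *m X)); rewrite CE BE mulmxDl -scalemxAl scalerN addrK.
exists D => //; apply: congr4_trans AD _.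
exact: congr4_diag2 (eqmx4_congr4 AB) (congr4_refl D).
Qed.

Lemma split_odd n (A : 'M[int]_(2 + n)) : even_sym A ->
  ~~ (2 %| A (lshift n 0%R) (lshift n 1%R))%Z ->
  exists2 D : 'M[int]_n, even_sym D &
    congr4 A (diag2 (sym2 2 1) D) \/ congr4 A (diag2 (sym2 0 1) D).
Proof.
move=> eA A_odd; have eB : even_sym (ulsubmx A).
  by case: eA => U ->; exists (ulsubmx U); apply/matrixP=> i j; rewrite !mxE.
have B_odd : ~~ (2 %| (ulsubmx A) 0%R 1%R)%Z by rewrite !mxE.
have [Y [K BY]] := odd_block_inv eB B_odd.
(* With [Y] inverse to the corner modulo 4, the equation for X has this solution. *)
have [|D eD AD] := @congr4_split _ _ A (Y *m ursubmx A) eA.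
  exists (- (K *m ursubmx A)).
  by rewrite mulmxA BY mulmxDl mul1mx -scalemxAl scalerN addrK.
exists D => //; have [h|h] := odd_block_congr4 eB B_odd; [left|right];
exact: congr4_trans AD (congr4_diag2 h (congr4_refl D)).
Qed.

Lemma even_mxE m n (C : 'M[int]_(m, n)) :
  (forall i j, (2 %| C i j)%Z) -> exists Y, C = 2 *: Y.
Proof.
move=> C_even; exists (map_mx (fun x => (x %/ 2)%Z) C).
by apply/matrixP=> i j; rewrite !mxE mulrC divzK.
Qed.

Lemma split_two n (A : 'M[int]_(1 + n)) : even_sym A ->
  (forall i j, (2 %| A i j)%Z) -> ~~ (4 %| A (lshift n 0%R) (lshift n 0%R))%Z ->
  exists2 D : 'M[int]_n, even_sym D & congr4 A (diag2 (2%:M : 'M_1) D).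
Proof.
move=> eA A_even A2.
(* The block (2) is not invertible modulo 4, but it divides any even row. *)
have [i j|Y CE] := @even_mxE _ _ (ursubmx A); first by rewrite !mxE.
apply: (@congr4_split_eqmx4 _ _ _ _ Y) => //; last by rewrite mul_scalar_mx.
apply: eqmx4P => i j; rewrite !ord1 !mxE eqxx.
by case: (mod4_even (A_even (lshift n 0) (lshift n 0))) A2 => [->|].
Qed.

Lemma split_hyperbolic_two n (A : 'M[int]_(2 + n)) : even_sym A ->
  (forall i j, (2 %| A i j)%Z) -> (forall i, (4 %| A i i)%Z) ->
  ~~ (4 %| A (lshift n 0%R) (lshift n 1%R))%Z ->
  exists2 D : 'M[int]_n, even_sym D & congr4 A (diag2 (sym2 0 2) D).
Proof.
move=> eA A_even A_diag A2.
have [i j|Y CE] := @even_mxE _ _ (ursubmx A); first by rewrite !mxE.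
have A01 : (4 %| A (lshift n 0%R) (lshift n 1%R) - 2)%Z.
  by case: (mod4_even (A_even (lshift n 0) (lshift n 1))) A2 => [->|].
have AC : A (lshift n 1) (lshift n 0) = A (lshift n 0) (lshift n 1).
  by rewrite -{1}(even_sym_tr eA) mxE.
(* The product of (0 2; 2 0) and (0 1; 1 0) is twice the identity, and the upper right block is
   2Y. *)
apply: (@congr4_split_eqmx4 _ _ _ _ (sym2 0 1 *m Y)) => //.
  rewrite (mx2E (ulsubmx A)) sym2E.
  by apply: eqmx4_mx2; rewrite !mxE ?subr0 // AC.
rewrite mulmxA !sym2E mul_mx2 CE -mul_scalar_mx; congr (_ *m _).
by rewrite (mx2E 2%:M) !mxE.
Qed.

(** * The induction on the size *)

Lemma perm_pair n (a b i j : 'I_n) : a != b -> i != j ->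
  exists s : 'S_n, s a = i /\ s b = j.
Proof.
(* The left factor acts first: it fixes a and sends b to the point that the second transposition
   maps to j; the second sends a to i. *)
move=> ab ij; exists (tperm b (tperm a i j) * tperm a i)%g.
rewrite !permM tpermL tpermK; split=> //.
rewrite (@tpermD _ b _ a) ?tpermL //; first by rewrite eq_sym.
by rewrite -(inj_eq (@perm_inj _ (tperm a i))) tpermK tpermL eq_sym.
Qed.

(** The size of this normal form is a sum equal to m only provably, hence the cast. *)
Lemma normal_form_zero m : exists e : m = normal_form_dim 0 0 0 0 m,
  normal_form 0 0 0 0 m = castmx (e, e) 0.
Proof.
have E : m = normal_form_dim 0 0 0 0 m.
  by rewrite /normal_form_dim /copies_dim !big_ord0 sum_nat_const card_ord muln1.
exists E.
have Z d (B : 'M[int]_d) : copies 0 B = 0.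
  apply/matrixP => i; have := ltn_ord i.
  by rewrite {2}/copies_dim big_ord0.
rewrite /normal_form !Z /copies raddf0 mxdiag0 /diag2 !block_mx0.
by apply/matrixP=> i j; rewrite castmxE !mxE.
Qed.

(** One inductive step: split off [B], normalise the remainder [D], then sort [B] into the
    result. *)
Lemma congr4_attach n d k l l' (A : 'M[int]_n) (B : 'M[int]_d)
    (D : 'M[int]_k) (N : 'M[int]_l) (N' : 'M[int]_l') :
  congr4 A (diag2 B D) -> congr4 D N -> congr4 (diag2 B N) N' -> congr4 A N'.
Proof.
move=> AD DN; apply: congr4_trans; apply: congr4_trans AD _.
exact: congr4_diag2 (congr4_refl B) DN.
Qed.

Lemma congr4_normal_form n (A : 'M[int]_n) : even_sym A ->
  exists r s t p m, congr4 A (normal_form r s t p m).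
Proof.
elim/ltn_ind: n A => n IH A eA.
have [/existsP[i /existsP[j Aij]]|A_even] :=
    boolP [exists i, exists j, ~~ (2 %| A i j)%Z].
  have ij : i != j by apply: contraNneq Aij => ->; exact: even_sym_diag.
  (* An off-diagonal entry forces size at least 2; a permutation brings it to position (0, 1). *)
  case: n => [|[|n]] in IH A eA i j Aij ij *; first by case: (i).
    by rewrite !ord1 eqxx in ij.
  have [s [s0 s1]] :=
    @perm_pair (2 + n) (lshift n 0%R) (lshift n 1%R) _ _ isT ij.
  have := @split_odd n _ (even_sym_perm s eA); rewrite !mxE.
  rewrite s0 s1 => /(_ Aij)[D eD AD].
  have [|r [s' [t [p [m DN]]]]] := IH n _ D eD; first by rewrite ltnS ltnW.
  case: AD => /(congr4_trans (congr4_perm s A)) /congr4_attach/(_ DN) AN.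
    by exists r.+1, s', t, p, m; apply: AN; exact: congr4_copies.
  exists r, s'.+1, t, p, m; apply: AN.
  by apply: congr4_skip; exact: congr4_copies.
have {}A_even i j : (2 %| A i j)%Z.
  by apply: contraNT A_even => Aij; apply/existsP; exists i; apply/existsP; exists j.
have [/existsP[i Aii]|A_diag] := boolP [exists i, ~~ (4 %| A i i)%Z].
  case: n => [|n] in IH A eA A_even i Aii *; first by case: (i).
  have := @split_two n _ (even_sym_perm (@tperm 'I_(1 + n) (lshift n 0%R) i) eA); rewrite !mxE.
  rewrite tpermL => /(_ _ Aii)[k l|D eD AD]; first by rewrite mxE.
  have [|r [s [t [p [m DN]]]]] := IH n _ D eD; first exact: ltnSn.
  exists r, s, t, p.+1, m.
  apply: congr4_attach (congr4_trans (congr4_perm _ A) AD) DN _.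
  (* The runs of (2 1; 1 2), (0 1; 1 0) and (0 2; 2 0) precede that of (2). *)
  by do 3!apply: congr4_skip; exact: congr4_copies.
have {}A_diag i : (4 %| A i i)%Z.
  by apply: contraNT A_diag => Aii; apply/existsP; exists i.
have [/existsP[i /existsP[j Aij]]|A0] :=
    boolP [exists i, exists j, ~~ (4 %| A i j)%Z].
  have ij : i != j by apply: contraNneq Aij => ->.
  case: n => [|[|n]] in IH A eA A_even A_diag i j Aij ij *; first by case: (i).
    by rewrite !ord1 eqxx in ij.
  have [s [s0 s1]] :=
    @perm_pair (2 + n) (lshift n 0%R) (lshift n 1%R) _ _ isT ij.
  have := @split_hyperbolic_two n _ (even_sym_perm s eA); rewrite !mxE.
  rewrite s0 s1 => /(_ _ _ Aij)[k l|k|D eD AD]; try by rewrite mxE.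
  have [|r [s' [t [p [m DN]]]]] := IH n _ D eD; first by rewrite ltnS ltnW.
  exists r, s', t.+1, p, m.
  apply: congr4_attach (congr4_trans (congr4_perm _ A) AD) DN _.
  by do 2!apply: congr4_skip; exact: congr4_copies.
(* Every entry is now 0 modulo 4, so only zero blocks remain. *)
exists 0%N, 0%N, 0%N, 0%N, n; have [e ->] := normal_form_zero n.
apply: congr4_trans (congr4_cast e 0); apply/eqmx4_congr4/eqmx4P => i j.
rewrite mxE subr0; apply: contraNT A0 => Aij.
by apply/existsP; exists i; apply/existsP; exists j.
Qed.

(** * Reduction modulo 4 and conclusion *)

Lemma mod4_mx_id m n (M : 'M[int]_(m, n)) :
  (forall i j, 0 <= M i j < 4) -> mod4_mx M = M.
Proof. by move=> M4; apply/matrixP=> i j; rewrite mxE modz_small. Qed.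

Lemma mod4_diag2 d k (B : 'M[int]_d) (C : 'M[int]_k) :
  mod4_mx B = B -> mod4_mx C = C -> mod4_mx (diag2 B C) = diag2 B C.
Proof.
move=> BE CE; rewrite /mod4_mx map_block_mx -!/(mod4_mx _) BE CE.
by rewrite !mod4_mx_id // => i j; rewrite mxE.
Qed.

Lemma mod4_copies k d (B : 'M[int]_d) :
  mod4_mx B = B -> mod4_mx (copies k B) = copies k B.
Proof.
move=> BE; apply/matrixP=> i j; rewrite !mxE.
case: eqP => _; last by rewrite mxE.
by rewrite conform_mx_id -{2}BE mxE.
Qed.

(** All entries already lie in {0, 1, 2}, so congruence to the normal form gives equality after
    reduction. *)
Lemma mod4_normal_form r s t p m :
  mod4_mx (normal_form r s t p m) = normal_form r s t p m.
Proof.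
by do !apply: mod4_diag2; apply: mod4_copies; apply: mod4_mx_id => i j;
  rewrite mxE; case: eqP.
Qed.

Theorem theorem1p1 (n : nat) (A : 'M[int]_n)
    (A_sym : A^T = A)
    (A_even : forall i : 'I_n, (2 %| A i i)%Z) :
  exists (P : 'M[int]_n) (p r s t m : nat)
         (dimE : normal_form_dim r s t p m = n),
    (\det P = 1 \/ \det P = -1) /\
    mod4_mx (P^T *m A *m P) = castmx (dimE, dimE) (normal_form r s t p m).
Proof.
have [r [s [t [p [m [Q [Q' [QQ' Q'Q QE]]]]]]]] :=
  congr4_normal_form (even_symP A_sym A_even).
(* Each one-sided inverse identity bounds one size by the other. *)
have dimE : normal_form_dim r s t p m = n.
  by apply/eqP; rewrite eqn_leq (mulmx1_min QQ') (mulmx1_min Q'Q).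
(* Substituting the size makes [Q] square and the cast trivial. *)
case: n / dimE in A A_sym A_even Q Q' QQ' Q'Q QE *.
exists Q, p, r, s, t, m, erefl; split.
  (* The determinant is a unit of the integers, hence 1 or -1. *)
  have /mulmx1_unit[Q_unit _] := QQ'.
  by move: Q_unit; rewrite unitmxE => /orP[] /eqP; [left|right].
by rewrite castmx_id (eqmx4_mod4 QE) mod4_normal_form.
Qed.
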